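(* Let $R$ be a Prüfer domain and let $Q$ be an ideal of $R$. Then $Q$ is a special 2-absorbing primary ideal of $R$ if and only if $Q[X]$ is a special 2-absorbing primary ideal of the polynomial ring $R[X]$.
   Context: All rings are commutative with $1\neq 0$. $Q[X]=QR[X]$ is the ideal of polynomials in $R[X]$ all of whose coefficients lie in $Q$. A proper ideal $Q$ of a ring $R$ is special 2-absorbing primary if whenever $a,b,c\in R$ satisfy $abc\in Q$, $ab\notin Q$ and $ac\notin\sqrt{Q}$, then $bc\in Q$, where $\sqrt{Q}$ is the radical of $Q$. *)

(* Defs.v *)
From HB Require Import structures.
From mathcomp Require Import all_boot all_order all_algebra.
From mathcomp Require Import boolp classical_sets.

Set Implicit Arguments.
Unset Strict Implicit.
Unset Printing Implicit Defensive.

Import GRing.Theory.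

Local Open Scope classical_set_scope.
Local Open Scope ring_scope.

(* MathComp's [idealr_closed] concerns boolean predicates and builds in        *)
(* properness; here ideals are arbitrary subsets and may be the whole ring.    *)
Definition is_ideal (R : comNzRingType) (I : set R) : Prop :=
  [/\ I 0,
      forall x y, I x -> I y -> I (x + y) &
      forall r x, I x -> I (r * x)].

Definition radical (R : comNzRingType) (I : set R) : set R :=
  [set x | exists2 n, (0 < n)%N & I (x ^+ n)].

Definition special_2absorbing_primary (R : comNzRingType) (Q : set R) : Prop :=
  [/\ is_ideal Q,
      Q <> setT &
      forall a b c : R,
        Q (a * b * c) -> ~ Q (a * b) -> ~ radical Q (a * c) -> Q (b * c)].

Definition poly_ideal (R : comNzRingType) (Q : set R) : set {poly R} :=
  [set p | forall i, Q p`_i].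

Definition ideal_gen (R : comNzRingType) (s : seq R) : set R :=
  [set x | exists t : 'I_(size s) -> R, x = \sum_(i < size s) t i * s`_i].

Definition finitely_generated (R : comNzRingType) (I : set R) : Prop :=
  exists s : seq R, I = ideal_gen s.

Definition is_fractional_ideal (R : idomainType) (J : set {fraction R}) : Prop :=
  [/\ J 0,
      forall x y, J x -> J y -> J (x + y),
      forall (r : R) x, J x -> J (tofrac r * x) &
      exists2 d : R, d != 0 &
        forall x, J x -> exists r : R, tofrac d * x = tofrac r].

Definition fractional_mul (R : idomainType) (I J : set {fraction R}) :
    set {fraction R} :=
  [set x | exists2 s : seq ({fraction R} * {fraction R}),
     forall p, p \in s -> I p.1 /\ J p.2 & x = \sum_(p <- s) p.1 * p.2].

Definition fractional_of (R : idomainType) (I : set R) : set {fraction R} :=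
  [set tofrac x | x in I].

Definition invertible_ideal (R : idomainType) (I : set R) : Prop :=
  exists2 J : set {fraction R}, is_fractional_ideal J &
    fractional_mul (fractional_of I) J = fractional_of setT.

Definition prufer_domain (R : idomainType) : Prop :=
  forall I : set R, is_ideal I -> finitely_generated I -> I <> [set 0] ->
    invertible_ideal I.

(* Main.v *)
Require Import Defs.
From HB Require Import structures.
From mathcomp Require Import all_boot all_order all_algebra.
From mathcomp Require Import boolp classical_sets.

(** Constants embed [R] in [{poly R}] compatibly with [poly_ideal] and with
    radicals, so the property descends from [Q[X]] to [Q].

    For the converse, let [c(f)] be the ideal generated by the coefficients of
    [f].  Over a Pruefer domain Gauss's lemma holds in the form
    [c(fg) = c(f) c(g)]; what is needed of it is that [fg] lies in [Q[X]] only
    if every product [f_i g_j] lies in [Q] ([prufer_gauss]).  Then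
    [fgh \in Q[X]], [fg \in Q[X]] and [fh \in rad(Q[X])] become statements
    about products of the ideals [c(f)], [c(g)], [c(h)], and the special
    2-absorbing primary condition passes from elements to ideals in any
    commutative ring ([special_2absorbing_primary_ideals]).  The last point is
    a subgroup argument: if some [a0] in [I] escapes a subgroup, then so does
    [a] or [a + a0] for every [a] in [I], hence an inclusion that
    holds for the escaping elements holds on all of [I].

    Gauss's lemma is obtained by inverting [c(f)].  If [y] lies in the inverse
    of [c(f)], then [F := y f] has coefficients in [R], and the coefficients of
    all such [F] generate the unit ideal.  Since [f_k F = F_k f], the product
    of [F] with [f_k g] is in [Q[X]].  In any commutative ring this forces a
    power of each coefficient of [F] to multiply [f_k g] into [Q[X]]
    ([exp_coef_mul_poly_ideal], a radical version of the Dedekind-Mertens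
    lemma).  So the radical of [(Q : f_k g_j)] contains the coefficients of
    every such [F], hence [1], which means that [f_k g_j] is in [Q]. *)

Set Implicit Arguments.
Unset Strict Implicit.
Unset Printing Implicit Defensive.

Import GRing.Theory.

Local Open Scope classical_set_scope.
Local Open Scope ring_scope.

(** * Ideals and radicals *)

Section Ideals.
Variable R : comNzRingType.
Implicit Types (Q I J K T : set R) (s : seq R).

Lemma is_idealMr Q r x : is_ideal Q -> Q x -> Q (x * r).
Proof. by move=> [_ _ QM] Qx; rewrite mulrC; apply: QM. Qed.

Lemma is_idealB Q x y : is_ideal Q -> Q x -> Q y -> Q (x - y).
Proof. by move=> [_ QD QM] Qx Qy; apply: QD => //; rewrite -mulN1r; apply: QM. Qed.

Lemma is_ideal_sum Q (A : Type) (r : seq A) (P : pred A) (F : A -> R) :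
  is_ideal Q -> (forall i, P i -> Q (F i)) -> Q (\sum_(i <- r | P i) F i).
Proof. by move=> [Q0 QD _] QF; apply: big_ind. Qed.

Lemma is_ideal_colon Q x : is_ideal Q -> is_ideal [set r | Q (r * x)].
Proof.
move=> [Q0 QD QM]; split=> [|y z /= Qy Qz|r y /= Qy].
- by rewrite /= mul0r.
- by rewrite mulrDl; apply: QD.
- by rewrite -mulrA; apply: QM.
Qed.

Lemma is_ideal_colon_set Q J :
  is_ideal Q -> is_ideal [set r | forall x, J x -> Q (r * x)].
Proof.
move=> [Q0 QD QM]; split=> [x _|y z /= Qy Qz x Jx|r y /= Qy x Jx].
- by rewrite mul0r.
- by rewrite mulrDl; apply: QD; [apply: Qy|apply: Qz].
- by rewrite -mulrA; apply: QM; apply: Qy.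
Qed.

Lemma is_ideal_radical Q : is_ideal Q -> is_ideal (radical Q).
Proof.
move=> idQ; have [Q0 QD QM] := idQ; split.
- by exists 1%N.
- move=> x y [m m0 Qx] [n n0 Qy]; exists (m + n)%N; first by rewrite addn_gt0 m0.
  rewrite exprDn; apply: is_ideal_sum => // i _; rewrite -mulr_natl; apply: (QM).
  have [le_ni|lt_in] := leqP n i.
    by rewrite -(subnK le_ni) exprD mulrA; apply: (QM).
  have -> : (m + n - i = n - i + m)%N by rewrite -addnBA ?(ltnW lt_in) // addnC.
  by rewrite exprD mulrAC; apply: (QM).
- by move=> r x [n n0 Qx]; exists n => //; rewrite exprMn; apply: QM.
Qed.

Lemma is_ideal_gen s : is_ideal (ideal_gen s).
Proof.
split=> [|_ _ [t ->] [u ->]|r _ [t ->]].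
- by exists (fun=> 0); rewrite big1 // => i _; rewrite mul0r.
- exists (fun i => t i + u i); rewrite -big_split; apply: eq_bigr => i _.
  by rewrite mulrDl.
- exists (fun i => r * t i); rewrite mulr_sumr; apply: eq_bigr => i _.
  by rewrite mulrA.
Qed.

Lemma ideal_gen_nth s i : ideal_gen s s`_i.
Proof.
have [le_si|lt_is] := leqP (size s) i.
  by rewrite nth_default //; case: (is_ideal_gen s).
exists (fun j => (j == Ordinal lt_is)%:R).
rewrite (bigD1 (Ordinal lt_is)) //= eqxx mul1r big1 ?addr0 // => j /negPf->.
by rewrite mul0r.
Qed.

Lemma ideal_gen_colon Q s x :
  is_ideal Q -> (forall i, Q (s`_i * x)) -> forall a, ideal_gen s a -> Q (a * x).
Proof.
move=> idQ Qs _ [t ->]; rewrite mulr_suml; apply: is_ideal_sum => // i _.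
by case: idQ => _ _ QM; rewrite -mulrA; apply: QM.
Qed.

(** If [a] is in [J], then [a + a0] and [a0] are not, and [a] is their
    difference: the elements of [I] outside [J] generate [I]. *)
Lemma sub_of_escaping I J T a0 :
    is_ideal I -> is_ideal J -> is_ideal T -> I a0 -> ~ J a0 ->
    (forall a, I a -> ~ J a -> T a) ->
  forall a, I a -> T a.
Proof.
move=> [_ ID _] idJ idT Ia0 nJa0 sIT a Ia.
have [Ja|nJa] := pselect (J a); last exact: sIT.
rewrite -(addrK a0 a); apply: (is_idealB idT); apply: sIT => //; first exact: ID.
by move=> Jaa0; apply: nJa0; rewrite -(addKr a a0) addrC; apply: is_idealB.
Qed.

(** If neither [IJ] nor [JK] is
    inside [Q], the elements [a] of [I] with [aJ] not inside [Q] and the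
    elements [c] of [K] with [cJ] not inside [Q] satisfy [ac \in rad Q], because
    [J] is not the union of its subgroups [(Q : a)] and [(Q : c)]; such elements
    [a] and [c] generate [I] and [K]. *)
Lemma special_2absorbing_primary_ideals Q I J K :
    special_2absorbing_primary Q -> is_ideal I -> is_ideal J -> is_ideal K ->
    (forall a b c, I a -> J b -> K c -> Q (a * b * c)) ->
  [\/ forall a b, I a -> J b -> Q (a * b),
      forall a c, I a -> K c -> radical Q (a * c) |
      forall b c, J b -> K c -> Q (b * c)].
Proof.
move=> [idQ _ absQ] idI idJ idK QIJK; have [_ JD _] := idJ.
pose S := [set r | forall x, J x -> Q (r * x)].
have idS : is_ideal S by apply: is_ideal_colon_set.
have escape a c : I a -> K c -> ~ S a -> ~ S c -> radical Q (a * c).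
  move=> Ia Kc nSa nSc; apply: contrapT => nac.
  have Jcover b : J b -> Q (a * b) \/ Q (b * c).
    move=> Jb; have [|nab] := pselect (Q (a * b)); first by left.
    by right; apply: absQ nab nac; apply: QIJK.
  have /existsNP[b /not_implyP[Jb nab]] := nSa.
  have /existsNP[b' /not_implyP[Jb' ncb']] := nSc.
  have Qbc : Q (b * c) by case: (Jcover b Jb).
  have Qab' : Q (a * b').
    by case: (Jcover b' Jb') => //; rewrite mulrC => /ncb'.
  case: (Jcover (b + b') (JD _ _ Jb Jb')) => Qsum.
    by apply: nab; rewrite -(addrK (a * b') (a * b)) -mulrDr; apply: is_idealB.
  by apply: ncb'; rewrite mulrC -(addKr (b * c) (b' * c)) addrC -mulrDl;
    apply: is_idealB.
have [sIS|/existsNP[a0 /not_implyP[Ia0 nSa0]]] := pselect (forall a, I a -> S a).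
  by constructor 1 => a b /sIS; apply.
have [sKS|/existsNP[c0 /not_implyP[Kc0 nSc0]]] := pselect (forall c, K c -> S c).
  by constructor 3 => b c Jb /sKS; rewrite mulrC; apply.
have idrad := is_ideal_radical idQ.
constructor 2 => a c Ia Kc.
have : [set r | radical Q (r * c)] a; last by [].
apply: (sub_of_escaping idI idS _ Ia0 nSa0) => //; first exact: is_ideal_colon.
move=> {Ia}a Ia nSa /=; rewrite mulrC.
have : [set r | radical Q (r * a)] c; last by [].
apply: (sub_of_escaping idK idS _ Kc0 nSc0) => //; first exact: is_ideal_colon.
by move=> {Kc}c Kc nSc /=; rewrite mulrC; apply: escape.
Qed.

End Ideals.

(** * The extension of an ideal to polynomials *)

Section PolyIdeals.
Variable R : comNzRingType.
Implicit Types Q : set R.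

Lemma poly_ideal_mul Q (p q : {poly R}) :
  is_ideal Q -> (forall i j, Q (p`_i * q`_j)) -> poly_ideal Q (p * q).
Proof. by move=> idQ Qpq i; rewrite coefM; apply: is_ideal_sum. Qed.

Lemma is_ideal_poly_ideal Q : is_ideal Q -> is_ideal (poly_ideal Q).
Proof.
move=> idQ; have [Q0 QD QM] := idQ; split=> [i|p q Qp Qq i|p q Qq].
- by rewrite coef0.
- by rewrite coefD; apply: QD.
- by apply: poly_ideal_mul => // i j; apply: QM.
Qed.

Lemma poly_idealZ Q a (p : {poly R}) :
  is_ideal Q -> poly_ideal Q p -> poly_ideal Q (a *: p).
Proof. by move=> [_ _ QM] Qp i; rewrite coefZ; apply: QM. Qed.

Lemma poly_idealC Q a : is_ideal Q -> poly_ideal Q a%:P <-> Q a.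
Proof.
move=> [Q0 _ _]; split=> [/(_ 0)|Qa i]; first by rewrite coefC.
by rewrite coefC; case: ifP.
Qed.

Lemma radical_poly_idealC Q a :
  is_ideal Q -> radical (poly_ideal Q) a%:P <-> radical Q a.
Proof.
move=> idQ; split=> -[n n0]; rewrite -?rmorphXn.
  by move=> /(poly_idealC _ idQ); exists n.
by exists n => //; rewrite -rmorphXn; apply/poly_idealC.
Qed.

Lemma radical_poly_ideal Q (p : {poly R}) :
  is_ideal Q -> poly_ideal (radical Q) p -> radical (poly_ideal Q) p.
Proof.
move=> idQ radp; rewrite -[p]coefK poly_def.
have idrad := is_ideal_radical (is_ideal_poly_ideal idQ).
apply: is_ideal_sum => // i _; rewrite -mul_polyC; apply: is_idealMr => //.
exact/radical_poly_idealC.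
Qed.

(** The product of [F`_m] with the top coefficient of [G] is the top
    coefficient of [F * G], so multiplying [G] by [F`_m] lowers its degree
    modulo [Q]. *)
Lemma exp_top_coef_mul_poly_ideal Q m n (F G : {poly R}) :
    is_ideal Q -> (size F <= m.+1)%N -> (size G <= n)%N ->
    poly_ideal Q (F * G) ->
  exists N, poly_ideal Q (F`_m ^+ N *: G).
Proof.
move=> idQ szF; have idQX := is_ideal_poly_ideal idQ.
elim: n G => [|n IHn] G szG QFG.
  move: szG; rewrite leqn0 size_poly_eq0 => /eqP->.
  by exists 0%N; rewrite scaler0; case: idQX.
have Qtop : Q (F`_m * G`_n).
  have := QFG (m + n)%N; rewrite coefM.
  have lt_m : (m < (m + n).+1)%N by rewrite ltnS leq_addr.
  rewrite (bigD1 (Ordinal lt_m)) //= addKn big1 ?addr0 // => i ne_im.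
  have [lt_im|le_mi] := ltnP i m.
    rewrite [G`__]nth_default ?mulr0 //; apply: leq_trans szG _.
    by rewrite -addnBAC ?(ltnW lt_im) // -[n.+1]add1n leq_add2r subn_gt0.
  rewrite nth_default ?mul0r //; apply: leq_trans szF _.
  by rewrite ltn_neqAle le_mi andbT eq_sym.
have splitG : F`_m *: G = F`_m *: take_poly n G + (F`_m * G`_n) *: 'X^n.
  apply/polyP => i; rewrite coefD !coefZ coef_take_poly coefXn.
  case: ltngtP => [_|lt_ni|->]; rewrite ?mulr0 ?addr0 ?add0r ?mulr1 //.
  by rewrite [G`_i]nth_default ?mulr0 //; apply: leq_trans szG _.
have Qtop' : poly_ideal Q ((F`_m * G`_n) *: 'X^n).
  by move=> i; rewrite coefZ; apply: is_idealMr.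
have [||N QN] := IHn (F`_m *: take_poly n G).
- by apply: leq_trans (size_scale_leq _ _) (size_take_poly _ _).
- rewrite -[_ *: _](addrK ((F`_m * G`_n) *: 'X^n)) -splitG mulrBr -scalerAr.
  apply: (is_idealB idQX); first exact: poly_idealZ.
  by case: idQX => _ _; apply.
exists N.+1; rewrite exprSr -scalerA splitG scalerDr.
by case: idQX => _ QXD _; apply: QXD => //; apply: poly_idealZ.
Qed.

(** Once a coefficient of [F] is inverted in [R / Q], the polynomial [F] has
    unit content, hence is not a zero divisor.  The induction on the degree of [F]
    peels off its top coefficient [a]: if [a ^+ N.+1 *: G] is in [Q[X]], the
    lower part of [F] multiplies [a ^+ N *: G] into [Q[X]], and replacing [G]
    by a suitable multiple lowers [N]. *)
Lemma exp_coef_mul_poly_ideal Q (F G : {poly R}) k :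
    is_ideal Q -> poly_ideal Q (F * G) ->
  exists N, poly_ideal Q (F`_k ^+ N *: G).
Proof.
move=> idQ; have idQX := is_ideal_poly_ideal idQ.
have : (size F <= size F)%N by [].
move: {2}(size F) => m; elim: m F G k => [|m IHm] F G k szF QFG.
  exists 1%N; move: szF; rewrite leqn0 size_poly_eq0 => /eqP->.
  by rewrite coef0 expr1 scale0r; case: idQX.
have [lt_km|le_mk] := ltnP k m; last first.
  have [eq_km|ne_km] := eqVneq k m.
    by rewrite eq_km; apply: exp_top_coef_mul_poly_ideal QFG.
  exists 1%N; rewrite nth_default ?expr1 ?scale0r; first by case: idQX.
  by apply: leq_trans szF _; rewrite ltn_neqAle eq_sym ne_km.
have [N] := exp_top_coef_mul_poly_ideal idQ szF (leqnn _) QFG.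
elim: N G QFG => [|N IHN] G QFG QNG.
  by exists 0%N; rewrite expr0 in QNG *.
have splitF : F = take_poly m F + F`_m *: 'X^m.
  apply/polyP => i; rewrite coefD coefZ coef_take_poly coefXn.
  case: ltngtP => [_|lt_mi|->]; rewrite ?mulr0 ?addr0 ?add0r ?mulr1 //.
  by rewrite nth_default //; apply: leq_trans szF _.
have [||M] := IHm (take_poly m F) (F`_m ^+ N *: G) k; first exact: size_take_poly.
  have -> : take_poly m F * (F`_m ^+ N *: G) =
      F`_m ^+ N *: (F * G) - 'X^m * (F`_m ^+ N.+1 *: G).
    rewrite {4}splitF mulrDl scalerDr -!scalerAl -!scalerAr scalerA -exprSr.
    by rewrite addrK.
  apply: (is_idealB idQX); first exact: poly_idealZ.
  by case: idQX => _ _; apply.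
rewrite coef_take_poly lt_km => QM.
have [||M' QM'] := IHN (F`_k ^+ M *: G).
- by rewrite -scalerAr; apply: poly_idealZ.
- by rewrite scalerA mulrC -scalerA.
by exists (M' + M)%N; rewrite exprD -scalerA.
Qed.

End PolyIdeals.

(** * Gauss's lemma over a Pruefer domain *)

(** For [I] invertible with inverse [J], the unit ideal is generated by the
    products [x * y] with [x] in [I] and [y] in [J]. *)
Lemma invertible_ideal_unit (R : idomainType) (I T : set R)
    (J : set {fraction R}) :
    fractional_mul (fractional_of I) J = fractional_of setT -> is_ideal T ->
    (forall x y, I x -> J y -> exists2 w, T w & tofrac w = tofrac x * y) ->
  T 1.
Proof.
move=> IJ1 [T0 TD _] Txy.
have : fractional_of setT (1 : {fraction R}) by exists 1 => //; rewrite rmorph1.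
rewrite -IJ1 => -[s s_IJ sum1].
have [w Tw w1] : exists2 w, T w & tofrac w = \sum_(p <- s) p.1 * p.2.
  rewrite big_seq.
  apply: (big_ind (fun z => exists2 w, T w & tofrac w = z)) => [|x y|p /s_IJ].
  - by exists 0; rewrite ?rmorph0.
  - by move=> [w Tw <-] [v Tv <-]; exists (w + v); [apply: TD|rewrite rmorphD].
  - by move=> [[x Ix <-] Jy]; apply: Txy.
suff -> : 1 = w by [].
by apply/eqP; rewrite -tofrac_eq w1 -sum1 rmorph1.
Qed.

(** Invertibility of [c(f)] replaces [f] by its multiples [y f] in [R[X]], whose
    coefficients together generate the unit ideal; for those, powers of
    coefficients are as good as the coefficients themselves, so the radical
    version of the Dedekind-Mertens lemma loses nothing. *)
Lemma prufer_gauss (R : idomainType) (Q : set R) (f g : {poly R}) k j :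
    prufer_domain R -> is_ideal Q -> poly_ideal Q (f * g) ->
  Q (f`_k * g`_j).
Proof.
move=> prR idQ Qfg.
have [->|f_neq0] := eqVneq f 0; first by rewrite coef0 mul0r; case: idQ.
have [J _ IJ1] : invertible_ideal (ideal_gen f).
  apply: prR; [exact: is_ideal_gen|by exists f|move=> I0].
  have := ideal_gen_nth f (size f).-1.
  by rewrite I0 => /eqP; rewrite -/(lead_coef f) lead_coef_eq0 (negPf f_neq0).
have integral x y : ideal_gen f x -> J y -> exists r, tofrac r = tofrac x * y.
  move=> Ix Jy; suff : fractional_of setT (tofrac x * y) by case=> r; exists r.
  rewrite -IJ1; exists [:: (tofrac x, y)]; last by rewrite big_seq1.
  by move=> p; rewrite inE => /eqP->; split=> //; exists x.
pose T := radical [set r | Q (r * (f`_k * g`_j))].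
have idT : is_ideal T by apply/is_ideal_radical/is_ideal_colon.
suff [n _] : T 1 by rewrite /= expr1n mul1r.
apply: (invertible_ideal_unit IJ1 idT) => _ y [t ->] Jy.
(* [F] is [y f]. *)
have [F coefF] : exists F : {poly R}, forall i, tofrac F`_i = tofrac f`_i * y.
  have /choice[r rE] : forall i, exists r, tofrac r = tofrac f`_i * y.
    by move=> i; apply: integral Jy; apply: ideal_gen_nth.
  exists (\poly_(i < size f) r i) => i; rewrite coef_poly.
  by case: ltnP => // le_fi; rewrite [f`_i]nth_default // !rmorph0 mul0r.
have Ff : f`_k *: F = F`_k *: f.
  apply/polyP => i; rewrite !coefZ; apply/eqP.
  by rewrite -tofrac_eq !tofracM !coefF mulrA mulrAC.
have TF i : T F`_i.
  have [|N QN] := @exp_coef_mul_poly_ideal _ Q F (f`_k *: g) i idQ.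
    by rewrite -scalerAr scalerAl Ff -scalerAl; apply: poly_idealZ.
  (* [N] may be zero, but [radical] asks for a positive exponent. *)
  exists N.+1 => //=; rewrite exprS -mulrA; case: idQ => _ _; apply.
  by have := QN j; rewrite !coefZ.
exists (\sum_(i < size f) t i * F`_i).
  by apply: is_ideal_sum => // i _; case: idT => _ _; apply.
rewrite !rmorph_sum mulr_suml; apply: eq_bigr => i _.
by rewrite /= !tofracM coefF mulrA.
Qed.

(** * Special 2-absorbing primary ideals and polynomial extensions *)

Lemma special_2absorbing_primary_of_poly (R : comNzRingType) (Q : set R) :
    is_ideal Q -> special_2absorbing_primary (poly_ideal Q) ->
  special_2absorbing_primary Q.
Proof.
move=> idQ [_ properQX absQX]; split=> // [QT|a b c Qabc nab nac].
  by apply: properQX; rewrite QT; apply/seteqP; split.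
apply/(poly_idealC _ idQ); rewrite polyCM; apply: (absQX a%:P); rewrite -?polyCM.
- exact/poly_idealC.
- by move/(poly_idealC _ idQ).
- by move/(radical_poly_idealC _ idQ).
Qed.

Lemma special_2absorbing_primary_poly (R : idomainType) (Q : set R) :
    prufer_domain R -> special_2absorbing_primary Q ->
  special_2absorbing_primary (poly_ideal Q).
Proof.
move=> prR spQ; have [idQ properQ _] := spQ; split.
- exact: is_ideal_poly_ideal.
- move=> QXT; apply: properQ; apply/seteqP; split=> // a _.
  by apply/(poly_idealC _ idQ); rewrite QXT.
move=> f g h Qfgh nfg nfh.
(* Gauss's lemma for [f * (g * h)], then for [(f`_i *: g) * h]. *)
have Qcoef i j k : Q (f`_i * (g`_j * h`_k)).
  rewrite mulrA -(coefZ _ g); apply: (prufer_gauss _ _ prR idQ).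
  rewrite -scalerAl => l; rewrite coefZ.
  by apply: (prufer_gauss _ _ prR idQ); rewrite mulrA.
have Qcontent a b c :
    ideal_gen f a -> ideal_gen g b -> ideal_gen h c -> Q (a * b * c).
  move=> fa gb hc; rewrite mulrC; apply: ideal_gen_colon hc => // k.
  rewrite mulrA mulrC; apply: ideal_gen_colon gb => // j.
  by rewrite mulrA mulrC; apply: ideal_gen_colon fa => // i.
have [Qfg|Qfh|Qgh] := special_2absorbing_primary_ideals spQ
  (is_ideal_gen f) (is_ideal_gen g) (is_ideal_gen h) Qcontent.
- by case: nfg; apply: poly_ideal_mul => // i j; apply: Qfg; apply: ideal_gen_nth.
- case: nfh; apply: radical_poly_ideal => //.
  by apply: poly_ideal_mul => [|i j]; [apply: is_ideal_radical|apply: Qfh; apply: ideal_gen_nth].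
- by apply: poly_ideal_mul => // i j; apply: Qgh; apply: ideal_gen_nth.
Qed.

Theorem corollary3p13 (R : idomainType) (hR : prufer_domain R)
    (Q : set R) (hQ : is_ideal Q) :
  special_2absorbing_primary Q <-> special_2absorbing_primary (poly_ideal Q).
Proof.
split; first exact: special_2absorbing_primary_poly.
exact: special_2absorbing_primary_of_poly.
Qed.
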